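(* Suppose the (possibly composite) elastic body $(M,g,C)$ with interface $N$ and density $\rho$ is isotropic. Then $Z_{\mathrm{out}}$ (at the boundary $\partial M\times\mathbb R$) and $Z^+_{\mathrm{out}}+Z^-_{\mathrm{out}}$ (at the interface $N\times\mathbb R$) are elliptic in the mixed region $\mathcal M$.
   Context: Elastic body. $(M,g)$ is an oriented compact connected $3$-dimensional Riemannian manifold with smooth boundary $\partial M\neq\emptyset$; $N$ is a smooth orientable hypersurface in the interior $M^\circ$, with two sides $N^\pm$; the components of $M^\circ\setminus N$ extend as manifolds with smooth boundary. The stiffness tensor $C=(C^{ijkm})$ is real with $C^{ijkm}=C^{jikm}=C^{kmij}$ and positive definite on symmetric $2$-tensors; $\rho>0$; $C,\rho$ are smooth except for possible jumps across $N$. Isotropic means: $C^{ijkm}=\lambda g^{ij}g^{km}+\mu(g^{ik}g^{jm}+g^{im}g^{jk})$ with Lamé parameters $\lambda,\mu$ satisfying $\mu>0$ and $\lambda+\mu>0$. $(Lu)^i=-(C^{ijkm}u_{k;m})_{;j}$ has principal symbol $\ell(\xi)=(C^{ijkm}\xi_j\xi_m)$; the traction is $(Tu)^i=C^{ijkm}u_{k;m}n_j$ with $n$ the exterior unit conormal. $P=L-\rho D_t^2$, $D_t=-i\partial_t$, has principal symbol $p(\xi,\tau)=\ell(\xi)-\rho\tau^2\mathrm{Id}$; in the isotropic case $P$ is of real principal type, and $H$ denotes the Hamilton field of $\operatorname{Char}P=\{\det p=0\}\setminus 0$ with $Ht=1$. Impedance. At $\partial M$, or at one side of $N$, let $r\ge0$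 be the distance to the hypersurface (on that side), $\nu=dr$, and identify sections of $TM$ near the hypersurface with $r$-dependent sections of $TM$ restricted to it by parallel transport along normal geodesics. Let $D_r=-i\partial_r$. Then $iT=A_0D_r+A_1$ with $A_0,A_1$ tangential; for $\eta$ a covector of the hypersurface at $y$ the principal symbols are $a_0^{ik}=\nu_jC^{ijkm}\nu_m$, $a_1^{ik}=\nu_jC^{ijkm}\eta_m$, and put $a_2^{ik}=\eta_jC^{ijkm}\eta_m$. For $\gamma=(\eta,\tau)\neq0$ set $a(s)=p(\gamma+s\nu)=a_0s^2+(a_1+a_1^t)s+a_2-\rho\tau^2\in\operatorname{End}(\mathbb C\otimes T_yM)$. $\gamma$ is non-glancing if $Hr\ne0$ on $\operatorname{Char}P\cap(\gamma+\mathbb R\nu)$. The outgoing spectrum $\sigma_{\mathrm{out}}$ is the set of $s\in\mathbb C$ with $\operatorname{Im}s\ge0$, $\ker a(s)\neq0$, and $-\tau a'(s)$ positive definite on $\ker a(s)$ when $s$ is real. At non-glancing $\gamma$ there is a unique factorization $a(s)=(s-q^\sharp)a_0(s-q)$ with $\operatorname{spec}(q)=\sigma_{\mathrm{out}}$, $\operatorname{spec}(q^\sharp)\cap\operatorname{spec}(q)=\emptyset$; write $q=q_{\mathrm{out}}$. Microlocally near non-glancing points $P\equiv(D_r-Q^\sharp)A_0(D_r-Q_{\mathrm{out}})$ with $Q_{\mathrm{out}}$ a tangential first order pseudo-differential operator with principal symbol $q_{\mathrm{out}}$, and the outgoing Dirichlet-to-Neumann operator is $Z_{\mathrm{out}}=-i(A_0Q_{\mathrm{out}}+A_1)|_{r=0}$,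 with principal symbol $z_{\mathrm{out}}=-i(a_0q_{\mathrm{out}}+a_1)$. $Z^\pm_{\mathrm{out}}$ is the corresponding operator for the side $N^\pm$. Regions. $E$ (over $T^*(\partial M\times\mathbb R)$) and $E^\pm$ (over $T^*(N\times\mathbb R)$) are the rank $3$ bundles with fibers $\mathbb C\otimes T_yM$. Points of $T^*(N\times\mathbb R)\setminus0$ are non-glancing if they are so for both sides. $E_c$, $E_c^\pm$ are the sums of generalized eigenspaces of the respective $q_{\mathrm{out}}$ for eigenvalues with $\operatorname{Im}s>0$. The hyperbolic region $\mathcal H$ is the set of non-glancing points with $E_c=0$, resp. $E_c^+\cap E_c^-=0$; the elliptic region $\mathcal E$ is the set with $E_c=E$, resp. $E_c^+=E_c^-=E$; the mixed region $\mathcal M$ is the complement of $\mathcal H\cup\mathcal E$ in the non-glancing set. *)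

(* Defs.v *)
From HB Require Import structures.
From mathcomp Require Import all_boot all_order all_algebra complex.
From mathcomp Require Import ring.
From mathcomp Require Import all_classical all_reals all_analysis.

Set Implicit Arguments.
Unset Strict Implicit.
Unset Printing Implicit Defensive.
Import Order.TTheory GRing.Theory Num.Theory.
Import numFieldNormedType.Exports.
Local Open Scope classical_set_scope.
Local Open Scope ring_scope.

(* Principal symbols at a point y of a hypersurface and the regions they
   define involve only the values at y of the metric, the conormal, the
   stiffness tensor and the density.  All tensors at y are given by their
   components in a basis of T_yM, with dual basis in T_y^*M: tangent vectors are
   columns, covectors are rows, and endomorphisms of C (x) T_yM are 3 x 3
   matrices acting on columns.  Nothing depends on t, which is omitted. *)

Definition tensor4 (R : Type) : Type := 'I_3 -> 'I_3 -> 'I_3 -> 'I_3 -> R.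

(* <xi, zeta>_g, with g^{-1} the dual metric *)
Definition codot (R : realType) (g : 'M[R]_3) (xi zeta : 'rV[R]_3) : R :=
  (xi *m invmx g *m zeta^T) 0 0.

(* One side of a hypersurface at one of its points.  [conormal] is nu = dr with
   r >= 0 the distance to the hypersurface on that side, so it points into the
   side and the exterior conormal is n = - nu. *)
Record side (R : realType) := Side {
  metric : 'M[R]_3;
  conormal : 'rV[R]_3;
  stiffness : tensor4 R;
  density : R;
  metric_sym : metric^T = metric;
  metric_pos : forall v : 'cV[R]_3, v != 0 -> 0 < (v^T *m metric *m v) 0 0;
  conormal_unit : codot metric conormal conormal = 1;
  stiffness_sym : forall i j k m,
    stiffness i j k m = stiffness j i k m /\
    stiffness i j k m = stiffness k m i j;
  stiffness_pos : forall e : 'M[R]_3, e^T = e -> e != 0 ->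
    0 < \sum_i \sum_j \sum_k \sum_m stiffness i j k m * e i j * e k m;
  density_pos : 0 < density }.

Definition isotropic (R : realType) (S : side R) : Prop :=
  let gi := invmx (metric S) in
  exists lambda mu : R, [/\ 0 < mu, 0 < lambda + mu &
    forall i j k m, stiffness S i j k m =
      lambda * gi i j * gi k m + mu * (gi i k * gi j m + gi i m * gi j k)].

Section Symbols.
Variables (R : realType) (S : side R).
Local Notation C := R[i].
Local Notation toC := (map_mx (fun x : R => (x%:C)%C)).
Local Notation g := (metric S).
Local Notation nu := (conormal S).
Local Notation rho := (density S).

(* (xi_j C^{ijkm} zeta_m)^{ik} *)
Definition contract (xi zeta : 'rV[R]_3) : 'M[R]_3 :=
  \matrix_(i, k) \sum_j \sum_m xi 0 j * stiffness S i j k m * zeta 0 m.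

(* The stiffness tensor acts on covariant components u_k = g_{kl} u^l. *)
Definition lower (A : 'M[R]_3) : 'M[R]_3 := A *m g.

Definition ell (xi : 'rV[R]_3) : 'M[R]_3 := lower (contract xi xi).

Definition psymb (xi : 'rV[R]_3) (tau : R) : 'M[R]_3 :=
  ell xi - (rho * tau ^+ 2)%:M.

(* The fiber over y of Char P *)
Definition charP : set ('rV[R]_3 * R) :=
  [set z | z != 0 /\ \det (psymb z.1 z.2) = 0].

(* f is a real C^1 function with nonzero differential at z, and f = 0 is an
   equation of Char P near z *)
Definition charP_equation (z : 'rV[R]_3 * R) (f : 'rV[R]_3 * R -> R) : Prop :=
  [/\ \forall w \near z, charP w <-> f w = 0,
      \forall w \near z, differentiable f w,
      forall u, {for z, continuous (fun w => 'd f w u)} &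
      exists u, 'd f z u != 0].

(* The r-component at z of H = H_f / (H_f t).  As H_f = \partial_\xi f \partial_x
   + \partial_\tau f \partial_t - (fiber derivatives), only the derivatives of
   f along the fiber enter, and the choice of the equation f is immaterial. *)
Definition hamilton_r (f : 'rV[R]_3 * R -> R) (z : 'rV[R]_3 * R) : R :=
  'd f z (nu, 0) / 'd f z (0, 1).

(* Covectors of (hypersurface x R) at (y, t), except 0.  Identification by
   normal geodesics embeds those of the hypersurface as the annihilator of the
   normal vector. *)
Definition cotangent : set ('rV[R]_3 * R) :=
  [set c | codot g c.1 nu = 0 /\ c != 0].

Section AtCovector.
Variable c : 'rV[R]_3 * R.
Local Notation eta := c.1.
Local Notation tau := c.2.

Definition nonglancing : Prop :=
  forall s : R, charP (eta + s *: nu, tau) ->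
  forall f, charP_equation (eta + s *: nu, tau) f ->
    hamilton_r f (eta + s *: nu, tau) != 0.

Definition a0 : 'M[R]_3 := lower (contract nu nu).
Definition a1 : 'M[R]_3 := lower (contract nu eta).
Definition a1t : 'M[R]_3 := lower (contract nu eta)^T.
Definition a2 : 'M[R]_3 := lower (contract eta eta).

Definition asymb (s : C) : 'M[C]_3 :=
  s ^+ 2 *: toC a0 + s *: toC (a1 + a1t) + toC (a2 - (rho * tau ^+ 2)%:M).

Definition asymb' (s : C) : 'M[C]_3 := (s *+ 2) *: toC a0 + toC (a1 + a1t).

(* Positivity refers to the Hermitian inner product induced by g. *)
Definition sigma_out : set C :=
  [set s | [/\ 0 <= complex.Im s,
      exists2 v : 'cV[C]_3, v != 0 & asymb s *m v = 0 &
      complex.Im s = 0 -> forall v : 'cV[C]_3, v != 0 -> asymb s *m v = 0 ->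
        0 < ((map_mx conjc v)^T *m toC g *m
               (- (tau%:C)%C *: asymb' s) *m v) 0 0]].

Definition spec (q : 'M[C]_3) : set C := [set s | eigenvalue q s].

Definition outgoing_factor (q : 'M[C]_3) : Prop :=
  exists qsharp : 'M[C]_3,
  [/\ forall s, asymb s = (s%:M - qsharp) *m toC a0 *m (s%:M - q),
      spec q = sigma_out &
      spec qsharp `&` spec q = set0].

(* The outgoing factor exists and is unique at non-glancing c. *)
Definition q_out : 'M[C]_3 := xget 0 [set q | outgoing_factor q].

Definition z_out : 'M[C]_3 := - ('i)%C *: (toC a0 *m q_out + toC a1).

(* Sum of the generalized eigenspaces of q_out for the eigenvalues with
   Im s > 0, as the row space of a matrix.  Since [geigenspace] is about
   matrices acting on rows, q_out is transposed. *)
Definition E_c : 'M[C]_3 :=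
  (\sum_(s <- sval (closed_field_poly_normal (char_poly q_out))
          | (0 < complex.Im s)%R)
     geigenspace q_out^T s)%MS.

End AtCovector.
End Symbols.

(* a(s) = p(gamma + s nu) for real s *)
Lemma asymbE (R : realType) (S : side R) (c : 'rV[R]_3 * R) (s : R) :
  asymb S c (s%:C)%C =
  map_mx (fun x : R => (x%:C)%C) (psymb S (c.1 + s *: conormal S) c.2).
Proof.
have addE (xi xi' zeta : 'rV[R]_3) : contract S (xi + xi') zeta =
    contract S xi zeta + contract S xi' zeta.
  apply/matrixP => i k; rewrite !mxE -big_split; apply: eq_bigr => j _.
  by rewrite -big_split; apply: eq_bigr => m _; rewrite !mxE !mulrDl.
have sclE (t : R) (xi zeta : 'rV[R]_3) :
    contract S (t *: xi) zeta = t *: contract S xi zeta.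
  apply/matrixP => i k; rewrite !mxE mulr_sumr; apply: eq_bigr => j _.
  by rewrite mulr_sumr; apply: eq_bigr => m _; rewrite !mxE !mulrA.
have trE (xi zeta : 'rV[R]_3) : contract S xi zeta = (contract S zeta xi)^T.
  apply/matrixP => i k; rewrite !mxE exchange_big.
  apply: eq_bigr => m _; apply: eq_bigr => j _.
  have [_ ->] := stiffness_sym S i j k m.
  by rewrite mulrC [xi 0 j * _]mulrC mulrA.
have addrE (xi zeta zeta' : 'rV[R]_3) : contract S xi (zeta + zeta') =
    contract S xi zeta + contract S xi zeta'.
  by rewrite trE addE linearD /= -!trE.
have sclrE (t : R) (xi zeta : 'rV[R]_3) :
    contract S xi (t *: zeta) = t *: contract S xi zeta.
  by rewrite trE sclE linearZ /= -trE.
rewrite /psymb /ell addE sclE !addrE !sclrE (trE c.1 (conormal S)).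
rewrite /asymb /a0 /a1 /a1t /a2 /lower scalerDr scalerA !mulmxDl -!scalemxAl.
rewrite -rmorphXn -!(map_mxZ, map_mxD); congr map_mx.
rewrite scalerDr expr2; apply/matrixP => i k; rewrite !(mxE, mulmxDl).
ring.
Qed.

(* Data at the points of the boundary, and on both sides N^+ and N^- at the
   points of the interface N, of a possibly composite elastic body *)
Record elastic_body (R : realType) := ElasticBody {
  bdry : Type;
  intf : Type;
  bdry_side : bdry -> side R;
  intf_pos : intf -> side R;
  intf_neg : intf -> side R;
  intf_metric : forall y, metric (intf_neg y) = metric (intf_pos y);
  intf_conormal : forall y, conormal (intf_neg y) = - conormal (intf_pos y) }.

Definition isotropic_body (R : realType) (B : elastic_body R) : Prop :=
  [/\ forall y : bdry B, isotropic (bdry_side y),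
      forall y : intf B, isotropic (intf_pos y) &
      forall y : intf B, isotropic (intf_neg y)].

Section Regions.
Variables (R : realType) (B : elastic_body R).

(* A point (y, eta, tau) stands for the covectors (eta, tau) at (y, t), any t. *)
Definition bdry_nonglancing : set (bdry B * ('rV[R]_3 * R)) :=
  [set x | cotangent (bdry_side x.1) x.2 /\ nonglancing (bdry_side x.1) x.2].

Definition bdry_hyperbolic : set (bdry B * ('rV[R]_3 * R)) :=
  [set x | bdry_nonglancing x /\ E_c (bdry_side x.1) x.2 = 0].

Definition bdry_elliptic : set (bdry B * ('rV[R]_3 * R)) :=
  [set x | bdry_nonglancing x /\ row_full (E_c (bdry_side x.1) x.2)].

Definition bdry_mixed : set (bdry B * ('rV[R]_3 * R)) :=
  bdry_nonglancing `\` (bdry_hyperbolic `|` bdry_elliptic).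

Definition bdry_Z_out (x : bdry B * ('rV[R]_3 * R)) : 'M[R[i]]_3 :=
  z_out (bdry_side x.1) x.2.

Definition intf_nonglancing : set (intf B * ('rV[R]_3 * R)) :=
  [set x | [/\ cotangent (intf_pos x.1) x.2,
               nonglancing (intf_pos x.1) x.2 & nonglancing (intf_neg x.1) x.2]].

Definition intf_hyperbolic : set (intf B * ('rV[R]_3 * R)) :=
  [set x | intf_nonglancing x /\
    (E_c (intf_pos x.1) x.2 :&: E_c (intf_neg x.1) x.2)%MS = 0].

Definition intf_elliptic : set (intf B * ('rV[R]_3 * R)) :=
  [set x | [/\ intf_nonglancing x, row_full (E_c (intf_pos x.1) x.2) &
                                   row_full (E_c (intf_neg x.1) x.2)]].

Definition intf_mixed : set (intf B * ('rV[R]_3 * R)) :=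
  intf_nonglancing `\` (intf_hyperbolic `|` intf_elliptic).

Definition intf_Z_out (x : intf B * ('rV[R]_3 * R)) : 'M[R[i]]_3 :=
  z_out (intf_pos x.1) x.2 + z_out (intf_neg x.1) x.2.

End Regions.

(* Ellipticity, on a set A of covectors, of a pseudo-differential operator with
   principal symbol z *)
Definition elliptic_on (R : realType) (X : Type) (A : set X)
    (z : X -> 'M[R[i]]_3) : Prop :=
  forall x, A x -> z x \in unitmx.

(* Main.v *)
(* In an isotropic medium a(s) v = (l+m) xi^# (xi v) + (m |xi|^2 - rho tau^2) v
   with xi = eta + s nu, so the eigenvalues of q_out are i b (longitudinal,
   l + 2m) and i sg (shear, m), where (l+2m) (|eta|^2 - b^2) = rho tau^2 =
   m (|eta|^2 - sg^2), and z_out splits into a 2 x 2 block on span(eta^#, nu^#)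
   and multiplication by m sg on its complement.  If E_c is neither 0 nor full,
   then b > 0 and sg is purely imaginary, and E_c is the line of
   eta^# + i b nu^#.  At an interface two such lines, with opposite conormals,
   meet in 0, which is the hyperbolic case; so in the mixed region exactly one
   side has E_c full, hence sg > 0 there.  It remains to see that the summed
   2 x 2 block has nonzero determinant and that the sum of the m sg is nonzero;
   the latter has nonzero imaginary part. *)

From mathcomp Require Import all_boot all_order all_algebra complex.
From mathcomp Require Import ring lra.
From mathcomp Require Import all_classical all_reals all_analysis.
Require Import Defs.

Set Implicit Arguments.
Unset Strict Implicit.
Unset Printing Implicit Defensive.
Import Order.TTheory GRing.Theory Num.Theory.
Local Open Scope complex_scope.
Local Open Scope ring_scope.

(** * Generalized eigenspaces *)

Section GeneralizedEigenspaces.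
Variable K : closedFieldType.

Local Notation eigenvals q :=
  (sval (closed_field_poly_normal (char_poly q))).

Lemma char_poly_eigenvals n (q : 'M[K]_n) :
  char_poly q = \prod_(z <- eigenvals q) ('X - z%:P).
Proof.
case: closed_field_poly_normal => rs /= {1}->.
by rewrite (monicP (char_poly_monic q)) scale1r.
Qed.

Lemma mem_eigenvals n (q : 'M[K]_n) t : (t \in eigenvals q) = eigenvalue q t.
Proof.
by rewrite eigenvalue_root_char [in RHS]char_poly_eigenvals root_prod_XsubC.
Qed.

Lemma size_eigenvals n (q : 'M[K]_n) : size (eigenvals q) = n.
Proof.
have := size_char_poly q.
by rewrite [X in size (polyseq X)]char_poly_eigenvals size_prod_XsubC => -[].
Qed.

Lemma big_addsmx_sub (T : eqType) m n (rs : seq T) (P : pred T)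
    (A : T -> 'M[K]_n) (B : 'M[K]_(m, n)) :
  {in rs, forall z, P z -> (A z <= B)%MS} ->
  ((\sum_(z <- rs | P z) A z)%MS <= B)%MS.
Proof.
move=> sAB; rewrite big_seq_cond.
elim/big_ind: _ => [|A1 A2 sA1 sA2|z /andP[zrs Pz]]; first exact: sub0mx.
- by rewrite addsmx_sub sA1.
- exact: sAB.
Qed.

Lemma sub_big_addsmx (T : eqType) n (rs : seq T) (P : pred T)
    (A : T -> 'M[K]_n) z :
  z \in rs -> P z -> (A z <= \sum_(z <- rs | P z) A z)%MS.
Proof.
elim: rs => // y rs IH; rewrite in_cons big_cons => /orP[/eqP<- ->|zrs Pz].
  exact: addsmxSl.
by case: ifP => _; [apply: submx_trans (IH zrs Pz) (addsmxSr _ _) | exact: IH].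
Qed.

(** Powers of distinct linear factors are coprime, so [kermxpolyM] splits them off one at a time. *)
Lemma kermxpoly_prod_XsubC n (g : 'M[K]_n) k (rs : seq K) : uniq rs ->
  (kermxpoly g (\prod_(z <- rs) ('X - z%:P) ^+ k) <=
   \sum_(z <- rs) kermxpoly g (('X - z%:P) ^+ k))%MS.
Proof.
elim: rs => [_|z rs IH /= /andP[zrs urs]].
  by rewrite !big_nil kermxpoly1 sub0mx.
rewrite !big_cons kermxpolyM; first exact: addsmxS (submx_refl _) (IH urs).
rewrite prodrXl coprimep_expl // coprimep_expr // coprimep_sym.
by rewrite coprimep_XsubC root_prod_XsubC.
Qed.

Lemma char_poly_tr n (q : 'M[K]_n) : char_poly q^T = char_poly q.
Proof.
rewrite /char_poly -[in RHS]det_tr; congr (\det _).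
by apply/matrixP => i j; rewrite !mxE eq_sym.
Qed.

(** By Cayley-Hamilton, [q^T] is annihilated by a product of powers of its linear factors, whose
    kernels then span the space. *)
Lemma row_full_sum_geigenspace n (q : 'M[K]_n) (P : pred K) :
  (forall t, eigenvalue q t -> P t) ->
  row_full (\sum_(s <- eigenvals q | P s) geigenspace q^T s)%MS.
Proof.
case: n q => [|n] q Pq; first by rewrite /row_full !thinmx0 mxrank0.
(* The exponent [n.+1] is the one in [geigenspace] and bounds every multiplicity. *)
set rs := eigenvals q; pose p := \prod_(z <- undup rs) ('X - z%:P) ^+ n.+1.
have char_p : char_poly q^T %| p.
  rewrite char_poly_tr char_poly_eigenvals.
  rewrite -[X in X %| _]prodr_undup_exp_count /p.
  apply: (big_ind2 (fun p1 p2 => p1 %| p2)) => // [|z _].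
  - by move=> *; apply: dvdp_mul.
  - by rewrite dvdp_exp2l // (leq_trans (count_size _ _)) ?size_eigenvals.
have /eqmxP/andP[_ full] : (kermxpoly q^T p :=: 1)%MS.
  apply: kermxpoly_min; apply: dvdp_trans char_p; exact: mxminpoly_dvd_char.
rewrite -sub1mx; apply: submx_trans full _.
apply: submx_trans (kermxpoly_prod_XsubC _ _ (undup_uniq _)) _.
apply: big_addsmx_sub => z; rewrite mem_undup => zrs _.
by apply: sub_big_addsmx (zrs) _; apply: Pq; rewrite -mem_eigenvals.
Qed.

Lemma single_eigenvalue_nilpotent n (q : 'M[K]_n.+1) a :
  (forall t, eigenvalue q t -> t = a) -> (q - a%:M) ^+ n.+1 = 0.
Proof.
move=> qa; have := Cayley_Hamilton q; rewrite char_poly_eigenvals.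
have -> : eigenvals q = nseq n.+1 a.
  rewrite -[in RHS](size_eigenvals q); apply/all_pred1P/allP => t.
  by rewrite mem_eigenvals => /qa ->; apply/eqP.
rewrite big_nseq iter_mulr_1 => <-.
by rewrite rmorphXn /= rmorphB /= horner_mx_X horner_mx_C.
Qed.

End GeneralizedEigenspaces.

(* With r = x + i y and P = b x + b' r', Q = sg' r' - th y, equality of
   imaginary and real parts gives h P + b^2 Q = - 2 b h n and P Q = h n^2, hence
   (h P - b^2 Q)^2 = 0, whereas h P > b^2 Q. *)
Lemma psv_determinant_neq0 (R : realFieldType) (h b b' sg' th N r' mm : R)
    (r : R[i]) :
  0 < b -> b ^+ 2 < h -> th != 0 -> 0 < N -> 0 <= r' -> 0 <= sg' <= b' ->
  r * (h%:C - b%:C * (0 +i* th)) = N%:C ->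
  (b%:C * r + b'%:C * r'%:C) * ((0 +i* th) * r + sg'%:C * r'%:C) !=
  h%:C * (mm%:C + r'%:C - r) ^+ 2.
Proof.
move=> b0 bh th0 N0 r'0 /andP[sg0 sgb]; case: r => x y; simpc => -[e1 e2].
have h0 : 0 < h by apply: le_lt_trans bh; rewrite sqr_ge0.
have e3 : y = x * b * th / h.
  by apply/(mulIf (lt0r_neq0 h0)); rewrite mulfVK ?lt0r_neq0 //; lra.
have x0 : 0 < x.
  have : 0 < x * (h + (b * th) ^+ 2 / h).
    suff -> : x * (h + (b * th) ^+ 2 / h) = N by [].
    rewrite -e1 e3; field; exact: lt0r_neq0.
  rewrite pmulr_lgt0 //; apply: ltr_wpDr => //.
  by rewrite divr_ge0 ?sqr_ge0 // ltW.
apply/eqP; simpc => -[].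
have hy : h * y = x * b * th by lra.
set P := b * x + b' * r'; set n := mm + r' - x => re im.
pose Q := sg' * r' - th * y.
have {}im : P * h + b ^+ 2 * Q = - 2 * n * h * b.
  have xth0 : x * th != 0 by rewrite mulf_neq0 // lt0r_neq0.
  (* The factor [x * th] lets [hy] replace [x * b * th] by [h * y], after which the imaginary part
     [im] applies. *)
  apply: (mulIf xth0).
  have -> : (P * h + b ^+ 2 * Q) * (x * th) =
    h * (P * (th * x)) + b * (x * b * th) * Q by ring.
  have -> : - 2 * n * h * b * (x * th) = - 2 * n * h * (x * b * th) by ring.
  rewrite -hy; transitivity (h * (P * (th * x) + b * y * Q)); first ring.
  by rewrite /Q [sg' * r' - _]addrC im; ring.
have {}re : P * Q = h * n ^+ 2.
  have -> : P * Q = P * (- (th * y) + sg' * r') - b * y * (th * x) +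
    y * (x * b * th) by rewrite /Q; ring.
  by rewrite re -hy; ring.
have /eqP : (P * h - b ^+ 2 * Q) ^+ 2 = 0.
  have -> : (P * h - b ^+ 2 * Q) ^+ 2 =
    (P * h + b ^+ 2 * Q) ^+ 2 - 4 * h * b ^+ 2 * (P * Q) by ring.
  by rewrite im re; ring.
rewrite sqrf_eq0 => /eqP; apply/eqP/lt0r_neq0.
have -> : P * h - b ^+ 2 * Q =
  h * b * x + (h * b' - b ^+ 2 * sg') * r' + b ^+ 2 * (th * y).
  by rewrite /P /Q; ring.
have thy : 0 <= th * y.
  rewrite e3 (_ : th * (x * b * th / h) = th ^+ 2 * (x * b / h)); last by ring.
  by rewrite mulr_ge0 ?sqr_ge0 // divr_ge0 ?mulr_ge0 // ltW.
have hb : b ^+ 2 * sg' <= h * b' by rewrite ler_pM ?sqr_ge0 // ltW.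
rewrite -addrA ltr_wpDr ?mulr_gt0 //.
by rewrite addr_ge0 // mulr_ge0 ?sqr_ge0 // subr_ge0.
Qed.

(** * Isotropic symbols on one side *)

Definition dot (K : nzRingType) n (f : 'rV[K]_n) (v : 'cV[K]_n) : K :=
  (f *m v) 0 0.

Section Dot.
Variables (K : comNzRingType) (n : nat).
Implicit Types (f : 'rV[K]_n) (v w : 'cV[K]_n) (k : K).

Lemma dotDl f f' v : dot (f + f') v = dot f v + dot f' v.
Proof. by rewrite /dot mulmxDl mxE. Qed.

Lemma dotDr f v w : dot f (v + w) = dot f v + dot f w.
Proof. by rewrite /dot mulmxDr mxE. Qed.

Lemma dotZl k f v : dot (k *: f) v = k * dot f v.
Proof. by rewrite /dot -scalemxAl mxE. Qed.

Lemma dotZr k f v : dot f (k *: v) = k * dot f v.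
Proof. by rewrite /dot -scalemxAr mxE. Qed.

Lemma dot0r f : dot f 0 = 0.
Proof. by rewrite /dot mulmx0 mxE. Qed.

Lemma mulmx_dot f v : f *m v = (dot f v)%:M.
Proof. by apply/matrixP=> i j; rewrite !ord1 !mxE eqxx mulr1n /dot mxE. Qed.

Lemma mul_dyad v f w : v *m f *m w = dot f w *: v.
Proof. by rewrite -mulmxA mulmx_dot mul_mx_scalar. Qed.

Lemma mul_dyad_row f v f' : f *m (v *m f') = dot f v *: f'.
Proof. by rewrite mulmxA mulmx_dot mul_scalar_mx. Qed.

End Dot.

Definition dotE := (dotDl, dotDr, dotZl, dotZr, dot0r).

Lemma metric_unit (R : realType) (S : side R) : metric S \in unitmx.
Proof.
rewrite unitmxE unitfE; apply/negP => /det0P [v v0 vg].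
have vT0 : v^T != 0.
  by apply: contra_neq v0 => /(congr1 trmx); rewrite trmxK trmx0.
by have := metric_pos S vT0; rewrite trmxK vg mul0mx mxE ltxx.
Qed.

(* [h] stands for |eta|^2 and [w] for rho tau^2; [i b] and [i sg] are the
   longitudinal and shear eigenvalues of q_out, so [sg] is real for evanescent
   and purely imaginary for propagating shear waves. *)
Definition impedance (R : realType) (S : side R) (c : 'rV[R]_3 * R)
    (h w mu b : R) (sg : R[i]) : Prop :=
  let H := map_mx (fun x : R => (x%:C)%C) c.1 in
  let N := map_mx (fun x : R => (x%:C)%C) (conormal S) in
  let r := w%:C / (h%:C - b%:C * sg) in
  [/\ forall v, dot H (z_out S c *m v) =
        r * b%:C * dot H v - 'i%C * h%:C * (2 * mu%:C - r) * dot N v,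
      forall v, dot N (z_out S c *m v) =
        'i%C * (2 * mu%:C - r) * dot H v + r * sg * dot N v &
      forall v, dot H v = 0 -> dot N v = 0 ->
        z_out S c *m v = (mu%:C * sg) *: v].

Section Isotropic.
Variables (R : realType) (S : side R).
Variables (lambda mu : R).
Hypothesis stiffE : forall i j k m, stiffness S i j k m =
  lambda * invmx (metric S) i j * invmx (metric S) k m +
  mu * (invmx (metric S) i k * invmx (metric S) j m +
        invmx (metric S) i m * invmx (metric S) j k).

Local Notation C := R[i].
Local Notation toC := (map_mx (fun x : R => (x%:C)%C)).
Local Notation g := (metric S).
Local Notation gi := (invmx (metric S)).

Lemma invmetric_sym : gi^T = gi.
Proof. by rewrite trmx_inv metric_sym. Qed.

Lemma codotC (xi zeta : 'rV[R]_3) : codot g xi zeta = codot g zeta xi.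
Proof.
rewrite /codot -[in LHS](trmxK (xi *m gi *m zeta^T)) [LHS]mxE.
by rewrite !trmx_mul trmxK invmetric_sym mulmxA.
Qed.

Lemma contract_isotropic (xi zeta : 'rV[R]_3) :
  contract S xi zeta =
  lambda *: (gi *m xi^T *m (zeta *m gi)) +
  mu *: (codot g xi zeta *: gi + gi *m zeta^T *m (xi *m gi)).
Proof.
have giC i j : gi i j = gi j i by rewrite -{1}invmetric_sym mxE.
apply/matrixP => i k; rewrite !mxE !big_ord1 /codot.
rewrite !mxE.
transitivity (lambda * ((\sum_j gi i j * xi 0 j) * (\sum_m zeta 0 m * gi m k))
  + mu * ((\sum_j (\sum_m xi 0 m * gi m j) * zeta 0 j) * gi i k
     + (\sum_m gi i m * zeta 0 m) * (\sum_j xi 0 j * gi j k))); last first.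
  do ![congr (_ + _) || congr (_ * _)]; apply: eq_bigr => j _; rewrite !mxE //.
rewrite !big_ord_recl !big_ord0 /=.
have stiffE' j m : stiffness S i j k m =
    lambda * gi i j * gi m k + mu * (gi i k * gi j m + gi i m * gi j k).
  by rewrite stiffE (giC k m).
rewrite !stiffE'; ring.
Qed.

Lemma lower_contract_isotropic (xi zeta : 'rV[R]_3) :
  lower S (contract S xi zeta) =
  lambda *: (gi *m xi^T *m zeta) +
  mu *: ((codot g xi zeta)%:M + gi *m zeta^T *m xi).
Proof.
rewrite /lower contract_isotropic mulmxDl -!scalemxAl mulmxDl -!scalemxAl.
by rewrite -!mulmxA mulVmx ?metric_unit // !mulmx1 scalemx1.
Qed.

(** * The quadratic pencil a(s) at a covector *)

Variable c : 'rV[R]_3 * R.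
Hypothesis cot : codot g c.1 (conormal S) = 0.

Local Notation N := (toC (conormal S)).
Local Notation H := (toC c.1).
Local Notation Ns := (toC (gi *m (conormal S)^T)).
Local Notation Hs := (toC (gi *m c.1^T)).
Local Notation l := lambda%:C.
Local Notation m := mu%:C.
Variables hr wr : R.
Hypothesis hrE : codot g c.1 c.1 = hr.
Hypothesis wrE : density S * c.2 ^+ 2 = wr.
Local Notation h := hr%:C.
Local Notation w := wr%:C.
Local Notation xi s := (H + s *: N).
Local Notation xis s := (Hs + s *: Ns).

Lemma dot_codot (x y : 'rV[R]_3) :
  dot (toC x) (toC (gi *m y^T)) = (codot g x y)%:C.
Proof. by rewrite /dot -map_mxM mxE /codot mulmxA. Qed.

Lemma dotNN : dot N Ns = 1.
Proof. by rewrite dot_codot conormal_unit. Qed.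

Lemma dotHN : dot H Ns = 0.
Proof. by rewrite dot_codot cot. Qed.

Lemma dotNH : dot N Hs = 0.
Proof. by rewrite dot_codot codotC cot. Qed.

Lemma dotHH : dot H Hs = h.
Proof. by rewrite dot_codot hrE. Qed.

Let dots := (dotE, dotNN, dotHN, dotNH, dotHH).

Lemma toC_lower_contract (x y : 'rV[R]_3) :
  toC (lower S (contract S x y)) =
  l *: (toC (gi *m x^T) *m toC y) + (m * (codot g x y)%:C)%:M +
  m *: (toC (gi *m y^T) *m toC x).
Proof.
rewrite lower_contract_isotropic map_mxD !map_mxZ map_mxD map_scalar_mx /=.
by rewrite (map_mxM _ (gi *m x^T)) (map_mxM _ (gi *m y^T)) scalerDr addrA
  scale_scalar_mx.
Qed.

Lemma contract_tr (x y : 'rV[R]_3) : (contract S x y)^T = contract S y x.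
Proof.
apply/matrixP => i k; rewrite !mxE exchange_big.
apply: eq_bigr => j _; apply: eq_bigr => n _.
have [_ ->] := stiffness_sym S k n i j; ring.
Qed.

Lemma toC_a0 : toC (a0 S) = (l + m) *: (Ns *m N) + m%:M.
Proof. by rewrite toC_lower_contract conormal_unit mulr1 scalerDl addrAC. Qed.

Lemma toC_a1 : toC (a1 S c) = l *: (Ns *m H) + m *: (Hs *m N).
Proof.
by rewrite toC_lower_contract codotC cot mulr0 (raddf0 scalar_mx) addr0.
Qed.

Lemma toC_a1t : toC (a1t S c) = l *: (Hs *m N) + m *: (Ns *m H).
Proof.
rewrite /a1t contract_tr toC_lower_contract cot mulr0 (raddf0 scalar_mx).
by rewrite addr0.
Qed.

Lemma a0_mul v : toC (a0 S) *m v = ((l + m) * dot N v) *: Ns + m *: v.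
Proof.
by rewrite toC_a0 mulmxDl -scalemxAl mul_dyad mul_scalar_mx scalerA.
Qed.

Lemma a1_mul v : toC (a1 S c) *m v =
  (l * dot H v) *: Ns + (m * dot N v) *: Hs.
Proof. by rewrite toC_a1 mulmxDl -!scalemxAl !mul_dyad !scalerA. Qed.

Lemma a1t_mul v : toC (a1t S c) *m v =
  (l * dot N v) *: Hs + (m * dot H v) *: Ns.
Proof. by rewrite toC_a1t mulmxDl -!scalemxAl !mul_dyad !scalerA. Qed.

(** The dyads formed from [Hs], [Ns] and [H], [N] assemble into a single one, and orthogonality of
    eta and nu gives |xi|^2 = h + s^2. *)
Lemma asymbE_isotropic s : asymb S c s =
  (l + m) *: (xis s *m xi s) + (m * (h + s ^+ 2) - w)%:M.
Proof.
rewrite /asymb wrE map_mxD map_mxB toC_a0 toC_a1 toC_a1t toC_lower_contract hrE.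
rewrite map_scalar_mx /= !(mulmxDl, mulmxDr) -!(scalemxAl, scalemxAr).
rewrite !raddfB /= mulrDr raddfD /= -!(scalemx1 _ m) -!(scalemx1 _ (m * _)).
move: (Ns *m N) (Ns *m H) (Hs *m N) (Hs *m H) => A1 A2 A3 A4.
apply/matrixP => i j; rewrite !mxE; ring.
Qed.

Lemma asymb_mul s v : asymb S c s *m v =
  ((l + m) * dot (xi s) v) *: xis s + (m * (h + s ^+ 2) - w) *: v.
Proof.
by rewrite asymbE_isotropic mulmxDl -scalemxAl mul_dyad mul_scalar_mx scalerA.
Qed.

Lemma mul_asymb s f : f *m asymb S c s =
  ((l + m) * dot f (xis s)) *: xi s + (m * (h + s ^+ 2) - w) *: f.
Proof.
rewrite asymbE_isotropic mulmxDr -scalemxAr mul_dyad_row mul_mx_scalar.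
by rewrite scalerA.
Qed.

Lemma dot_xi2 s t : dot (xi s) (xis t) = h + s * t.
Proof. by rewrite !dotE dotNN dotHN dotNH dotHH; ring. Qed.

Lemma dot_asymb s t : dot (xi s) (asymb S c t *m xis s) =
  (l + m) * (h + t * s) * (h + s * t) + (m * (h + t ^+ 2) - w) * (h + s * s).
Proof. by rewrite asymb_mul dotDr !dotZr !dot_xi2. Qed.

Hypothesis mu0 : 0 < mu.
Hypothesis lmu0 : 0 < lambda + mu.

Lemma dot_xi t : dot (xi t) (xis t) = h + t ^+ 2.
Proof. exact: dot_xi2. Qed.

Lemma lame_gt0 : 0 < lambda + 2 * mu.
Proof. by rewrite mulr_natl mulr2n addrA addr_gt0. Qed.

Lemma lameC : (lambda + 2 * mu)%:C = l + 2 * m.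
Proof. by rewrite !mulr_natl !mulr2n !rmorphD. Qed.

Lemma lame_neq0 : l + 2 * m != 0.
Proof. by rewrite -lameC fmorph_eq0 lt0r_neq0 // lame_gt0. Qed.

Lemma mu_neq0 : m != 0.
Proof. by rewrite fmorph_eq0 lt0r_neq0. Qed.

(** Pairing a(t) v = 0 with xi gives ((l + 2m)(h + t^2) - w) (xi v) = 0, and if xi v = 0 only the
    shear term of a(t) v remains. *)
Lemma kernel_speed t (v : 'cV[C]_3) : v != 0 -> asymb S c t *m v = 0 ->
  m * (h + t ^+ 2) = w \/ (l + 2 * m) * (h + t ^+ 2) = w.
Proof.
move=> v0; rewrite asymb_mul => av.
have [/eqP|k0] := eqVneq (m * (h + t ^+ 2) - w) 0.
  by rewrite subr_eq0 => /eqP; left.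
right; apply/eqP; rewrite -subr_eq0.
have := congr1 (dot (xi t)) av; rewrite dotDr !dotZr dot_xi dot0r.
move=> /eqP; have [x0|x0 /eqP e] := eqVneq (dot (xi t) v) 0.
  move: av; rewrite x0 mulr0 scale0r add0r => /eqP.
  by rewrite scaler_eq0 (negPf k0) (negPf v0).
by apply/eqP/(mulIf x0); rewrite mul0r -[RHS]e; ring.
Qed.

(** [a0] multiplies normal vectors by l + 2m and the kernel of [N] by m. *)
Lemma a0_unit : toC (a0 S) \in unitmx.
Proof.
rewrite -unitmx_tr unitmxE unitfE; apply/negP => /det0P [f f0 fa].
have {fa} : toC (a0 S) *m f^T = 0.
  by apply: trmx_inj; rewrite trmx_mul trmxK trmx0.
rewrite a0_mul => e.
have := congr1 (dot N) e; rewrite !dots => /eqP.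
have -> : (l + m) * dot N f^T * 1 + m * dot N f^T = (l + 2 * m) * dot N f^T.
  by ring.
rewrite mulf_eq0 (negPf lame_neq0) /= => /eqP n0.
move: e; rewrite n0 mulr0 scale0r add0r => /eqP.
rewrite scaler_eq0 (negPf mu_neq0) /= => /eqP/(congr1 trmx).
by rewrite trmxK trmx0; apply/eqP.
Qed.

(** * Spectrum of an outgoing factor *)

Section Factor.
Variable q : 'M[C]_3.
Hypothesis outq : outgoing_factor S c q.

Lemma eigenvalue_out t : eigenvalue q t <-> sigma_out S c t.
Proof. by have [qs [_ E _]] := outq; rewrite -E. Qed.

(** As [qs] and [q] have disjoint spectra, both left factors of a(t) = (t - qs) a0 (t - q) are
    invertible, so a(t) and t - q have the same kernel. *)
Lemma outgoing_eigenvector t (v : 'cV[C]_3) :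
  eigenvalue q t -> asymb S c t *m v = 0 -> q *m v = t *: v.
Proof.
have [qs [fac _ dis]] := outq => qt.
have qst : t%:M - qs \in unitmx.
  rewrite -opprB -scaleN1r unitmxZ ?unitrN1 // -row_free_unit -kermx_eq0.
  apply/negPn/negP => qst.
  have : (spec qs `&` spec q)%classic t by split; [exact: qst | exact: qt].
  by rewrite dis.
rewrite fac -!mulmxA => /(congr1 (mulmx (invmx (t%:M - qs)))).
rewrite mulKmx // mulmx0 => /(congr1 (mulmx (invmx (toC (a0 S))))).
rewrite mulKmx ?a0_unit // mulmx0 mulmxBl mul_scalar_mx => /eqP.
by rewrite subr_eq0 => /eqP.
Qed.

Lemma wr_ge0 : 0 <= wr.
Proof. by rewrite -wrE mulr_ge0 ?sqr_ge0 // ltW // density_pos. Qed.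

Lemma sqr_complex_real (t : C) (r : R) : t ^+ 2 = r%:C ->
  complex.Im t != 0 -> t = 0 +i* complex.Im t /\ r = - complex.Im t ^+ 2.
Proof.
case: t => x y; rewrite expr2; simpc => -[<- e] /= y0.
have x0 : x = 0.
  have : x * y *+ 2 = 0 by rewrite -[RHS]e; ring.
  by move/eqP; rewrite mulrn_eq0 mulf_eq0 (negPf y0) orbF => /eqP.
by rewrite x0; split=> //; ring.
Qed.

Lemma eigenvalue_sqr t : eigenvalue q t ->
  exists2 r, t ^+ 2 = r%:C &
    mu * (hr + r) = wr \/ (lambda + 2 * mu) * (hr + r) = wr.
Proof.
move=> /eigenvalue_out [_ [v v0 av] _].
case: (kernel_speed v0 av) => e.
  exists (wr / mu - hr).
    by rewrite rmorphB /= fmorph_div /= -e; field; exact: mu_neq0.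
  by left; field; exact: lt0r_neq0.
exists (wr / (lambda + 2 * mu) - hr).
  rewrite rmorphB fmorph_div /= lameC.
  by rewrite -e; field; exact: lame_neq0.
by right; field; exact: lt0r_neq0 lame_gt0.
Qed.

(** Longitudinal waves are faster than shear waves, since l + 2m > m; so they are evanescent as soon
    as any mode is. Here t^2 is real and negative, and b^2 is solved for. *)
Lemma longitudinal_speed t : eigenvalue q t -> 0 < complex.Im t ->
  exists2 b, 0 < b & (lambda + 2 * mu) * (hr - b ^+ 2) = wr.
Proof.
move=> qt t0; have [r rE re] := eigenvalue_sqr qt.
have [_ {}rE] := sqr_complex_real rE (lt0r_neq0 t0).
have r0 : r < 0 by rewrite rE oppr_lt0 exprn_gt0.
have lm0 := lame_gt0.
have w0 := wr_ge0.
suff wh : wr < (lambda + 2 * mu) * hr.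
  exists (Num.sqrt (hr - wr / (lambda + 2 * mu))).
    by rewrite sqrtr_gt0 subr_gt0 ltr_pdivrMr // [hr * _]mulrC.
  rewrite sqr_sqrtr; last by rewrite subr_ge0 ler_pdivrMr // [hr * _]mulrC ltW.
  by field; exact: lt0r_neq0.
have hr0 : 0 <= hr + r.
  case: re => e; first by rewrite -(pmulr_rge0 _ mu0) e.
  by rewrite -(pmulr_rge0 _ lm0) e.
have lh : 0 < (lambda + mu) * hr by rewrite mulr_gt0 //; lra.
case: re => <-; last by rewrite ltr_pM2l //; lra.
have mr : mu * r < 0 by rewrite pmulr_rlt0.
lra.
Qed.

(** A longitudinal eigenvalue has square -b^2 < 0, so a real one belongs to shear waves. The sign
    condition in [sigma_out] rules out 0. *)
Lemma real_eigenvalue s b : 0 < b -> (lambda + 2 * mu) * (hr - b ^+ 2) = wr ->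
  eigenvalue q s -> complex.Im s = 0 ->
  exists th, [/\ th != 0, s = th%:C & mu * (hr + th ^+ 2) = wr].
Proof.
move=> b0 hb qs; have [r rE re] := eigenvalue_sqr qs.
case: s qs rE => th y qs rE /= y0; rewrite {}y0 in qs rE *.
exists th; have {rE}rE : r = th ^+ 2.
  by move: rE; rewrite expr2; simpc => -[<-].
have lm0 := lame_gt0.
have re1 : mu * (hr + th ^+ 2) = wr.
  case: re => [|e]; rewrite ?rE //; exfalso.
  by move: e; rewrite rE -hb => /(mulfI (lt0r_neq0 lm0)); nra.
(* If th = 0, then [Ns] lies in the kernel of a(0), while a'(0) maps it to a multiple of [Hs], which
   [N] annihilates: the form is not positive on [Ns]. *)
split=> //; apply: contraTneq isT => th0.
have [_ _ pos] := (eigenvalue_out _).1 qs.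
have Ns0 : Ns != 0.
  by apply/eqP => /(congr1 (dot N)) /eqP; rewrite dotNN dot0r oner_eq0.
have aNs : asymb S c 0 *m Ns = 0.
  rewrite asymb_mul !dots mul0r addr0 mulr0 scale0r add0r.
  rewrite (_ : m * _ - w = 0) ?scale0r //; rewrite -re1 th0.
  by rewrite !(rmorphM, rmorphD, rmorphXn) /= subrr.
have := pos erefl Ns Ns0; rewrite th0 => /(_ aNs).
have -> : (map_mx conjc Ns)^T *m toC g = N.
  have -> : map_mx conjc Ns = Ns.
    by apply/matrixP => i j; rewrite !mxE conjc_real.
  rewrite map_trmx trmx_mul trmxK invmetric_sym -map_mxM.
  by rewrite mulmxKV ?metric_unit.
rewrite -mulmxA -scalemxAl -scalemxAr mxE -/(dot N _) /asymb' mul0rn scale0r.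
rewrite add0r map_mxD mulmxDl a1_mul a1t_mul !dotE dotNN dotHN dotNH.
by rewrite !(mulr0, mul0r, addr0) ltxx.
Qed.

(** * Consequences of an evanescent longitudinal mode *)

Section Longitudinal.
Variable b : R.
Hypothesis b0 : 0 < b.
Hypothesis hb : (lambda + 2 * mu) * (hr - b ^+ 2) = wr.

Local Notation ib := (0 +i* b)%C.

Lemma sqr_ib : ib ^+ 2 = - b%:C ^+ 2.
Proof. by rewrite !expr2; simpc. Qed.

Lemma ib_neq0 : ib != 0.
Proof. by rewrite eq_complex /= eqxx lt0r_neq0. Qed.

Lemma hbC : (l + 2 * m) * (h + ib ^+ 2) = w.
Proof. by rewrite sqr_ib -hb rmorphM rmorphB rmorphXn /= lameC. Qed.

Lemma longitudinal_mode : asymb S c ib *m xis ib = 0.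
Proof.
rewrite asymb_mul dot_xi -scalerDl -hbC.
by apply/eqP; rewrite scaler_eq0; apply/orP; left; apply/eqP; ring.
Qed.

Lemma longitudinal_neq0 : xis ib != 0.
Proof.
apply/eqP => /(congr1 (dot N)) /eqP; rewrite !dots add0r mulr1.
exact/negP/ib_neq0.
Qed.

Lemma eigenvalue_ib : eigenvalue q ib.
Proof.
apply/eigenvalue_out; split; first exact: ltW.
- by exists (xis ib); [exact: longitudinal_neq0 | exact: longitudinal_mode].
- by move=> /= b00; move: b0; rewrite b00 ltxx.
Qed.

Lemma q_longitudinal : q *m xis ib = ib *: xis ib.
Proof.
apply: outgoing_eigenvector; first exact: eigenvalue_ib.
exact: longitudinal_mode.
Qed.

Lemma h_gt0 : 0 < hr.
Proof.
have lm0 := lame_gt0.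
have w0 := wr_ge0; have : 0 < b ^+ 2 by rewrite exprn_gt0.
by rewrite -hb pmulr_rge0 // in w0; lra.
Qed.

Lemma hC_neq0 : h != 0.
Proof. by rewrite fmorph_eq0 lt0r_neq0 // h_gt0. Qed.

Lemma shear_mode sg : 0 < sg -> mu * (hr - sg ^+ 2) = wr ->
  eigenvalue q (0 +i* sg).
Proof.
(* [v] is the combination of [Hs] and [Ns] annihilated by eta + i sg nu, a shear polarization. *)
move=> sg0 hs; pose v := - (0 +i* sg) *: Hs + h *: Ns.
apply/eigenvalue_out; split; first exact: ltW.
- exists v.
    apply/eqP => /(congr1 (dot N)) /eqP; rewrite !dots mulr0 add0r mulr1.
    exact/negP/hC_neq0.
  rewrite asymb_mul.
  have -> : dot (xi (0 +i* sg)) v = 0 by rewrite /v !dots; ring.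
  rewrite mulr0 scale0r add0r.
  have -> : (0 +i* sg) ^+ 2 = - sg%:C ^+ 2 by rewrite !expr2; simpc.
  have -> : w = m * (h - sg%:C ^+ 2).
    by rewrite -hs rmorphM rmorphB rmorphXn.
  by rewrite subrr scale0r.
- by move=> /= sg00; move: sg0; rewrite sg00 ltxx.
Qed.

(** With d = h + (ib)^2 and w = (l + 2m) d, the scalar part of a(ib) is -(l + m) d, nonzero because
    w is; hence [v] is proportional to the range of the dyad. *)
Lemma longitudinal_kernel v : 0 < wr -> asymb S c ib *m v = 0 ->
  exists k, v = k *: xis ib.
Proof.
move=> w0; rewrite asymb_mul -hbC => av.
pose d := h + ib ^+ 2; have lmd : (l + m) * d != 0.
  have : w != 0 by rewrite fmorph_eq0 lt0r_neq0.
  rewrite -hbC !mulf_eq0 !negb_or => /andP[_ ->]; rewrite andbT.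
  by rewrite -rmorphD fmorph_eq0 lt0r_neq0.
exists ((l + m) * dot (xi ib) v / ((l + m) * d)).
apply: (scalerI lmd); rewrite scalerA mulrCA divff // mulr1.
apply/eqP; rewrite eq_sym -subr_eq0 -scaleNr -[X in _ == X]av.
by apply/eqP; congr (_ + _ *: _); rewrite /d; ring.
Qed.

(* The left-hand side is xi a'(ib) xi^#, since (ib - q) xi^# = 0; it is read off
   from a(ib + 1) - a(ib - 1). *)
Lemma dot_factor_derivative qs :
  (forall s, asymb S c s = (s%:M - qs) *m toC (a0 S) *m (s%:M - q)) ->
  dot (xi ib *m (ib%:M - qs) *m toC (a0 S)) (xis ib) = 2 * ib * w.
Proof.
move=> fac; set X := dot _ _; pose k := dot (xi ib) (toC (a0 S) *m xis ib).
have dE e : e * X + e ^+ 2 * k =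
    (l + m) * (h + (ib + e) * ib) * (h + ib * (ib + e))
    + (m * (h + (ib + e) ^+ 2) - w) * (h + ib * ib).
  rewrite -(dot_asymb ib (ib + e)).
  have -> : asymb S c (ib + e) *m xis ib =
      e *: ((ib%:M - qs) *m toC (a0 S) *m xis ib + e *: (toC (a0 S) *m xis ib)).
    rewrite fac -mulmxA (mulmxBl _ q) mul_scalar_mx q_longitudinal -scalerBl.
    rewrite (_ : ib + e - ib = e); last by ring.
    have -> : (ib + e)%:M - qs = (ib%:M - qs) + e%:M by rewrite raddfD addrAC.
    by rewrite -scalemxAr; move: (ib%:M - qs) => A; rewrite !mulmxDl
      mul_scalar_mx -scalemxAl.
  have -> : X = dot (xi ib) ((ib%:M - qs) *m toC (a0 S) *m xis ib).
    by rewrite /X /dot !mulmxA.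
  by rewrite dotZr dotDr dotZr -/k mulrDr mulrA -expr2.
move: X k dE => X k dE; have := dE 1; have := dE (-1).
rewrite -hbC; move: ib l m h => z l' m' h' e1 e2.
apply: (mulfI (_ : 2%:R != 0 :> C)); first by rewrite pnatr_eq0.
transitivity ((1 * X + 1 ^+ 2 * k) - (- 1 * X + (- 1) ^+ 2 * k)); first ring.
rewrite e1 e2; ring.
Qed.

(* Otherwise ib is the only eigenvalue of q, with a one-dimensional eigenspace,
   so the nilpotent n = q - ib is a single Jordan block.  Then the left
   eigenvector f = xi (ib - qs) a0 would vanish on xi^#, but
   f xi^# = xi a'(ib) xi^# <> 0. *)
Lemma shear_subcritical : (forall t, eigenvalue q t -> 0 < complex.Im t) ->
  wr < mu * hr.
Proof.
move=> posq; rewrite ltNge; apply/negP => hw.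
have w0 : 0 < wr by apply: lt_le_trans hw; rewrite mulr_gt0 // h_gt0.
(* A shear eigenvalue with negative square would give wr < mu hr, against [hw]; only the
   longitudinal speed is left. *)
have q1 t : eigenvalue q t -> t = ib.
  move=> qt; have t0 := posq _ qt; have [r rE re] := eigenvalue_sqr qt.
  have [-> {}rE] := sqr_complex_real rE (lt0r_neq0 t0).
  congr (0 +i* _); have := lame_gt0 => lm0.
  have r0 : r < 0 by rewrite rE oppr_lt0 exprn_gt0.
  case: re => [e|].
    by move: hw; rewrite leNgt -e mulrDr gtrDl pmulr_rlt0 // r0.
  rewrite rE -hb => /(mulfI (lt0r_neq0 lm0))/addrI/oppr_inj/eqP.
  by rewrite eqrXn2 // ?ltW // => /eqP.
have [n nE] : exists n, n = q - ib%:M by exists (q - ib%:M).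
have n3 : n *m (n *m n) = 0.
  by have := single_eigenvalue_nilpotent q1; rewrite -nE !exprS expr0 mulr1.
have [qs [fac _ _]] := outq.
have [f fE] : exists f, f = xi ib *m (ib%:M - qs) *m toC (a0 S).
  by exists (xi ib *m (ib%:M - qs) *m toC (a0 S)).
have fn : f *m n = 0.
  have -> : n = - (ib%:M - q) by rewrite opprB nE.
  have fq : f *m (ib%:M - q) = xi ib *m asymb S c ib by rewrite fac fE !mulmxA.
  rewrite mulmxN fq mul_asymb dot_xi -hbC -scalerDl.
  by apply/eqP; rewrite oppr_eq0 scaler_eq0; apply/orP; left; apply/eqP; ring.
have fx : dot f (xis ib) != 0.
  rewrite fE dot_factor_derivative //.
  apply: mulf_neq0; last by rewrite fmorph_eq0 lt0r_neq0.
  by apply: mulf_neq0; [rewrite pnatr_eq0 | exact: ib_neq0].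
(* A vector killed by [n] is on the longitudinal line, where [f] is injective. *)
have ker (v : 'cV[C]_3) : n *m v = 0 -> dot f v = 0 -> v = 0.
  rewrite nE mulmxBl mul_scalar_mx => /eqP; rewrite subr_eq0 => /eqP qv.
  have /(longitudinal_kernel w0)[k ->] : asymb S c ib *m v = 0.
    by rewrite fac -mulmxA (mulmxBl _ q) mul_scalar_mx qv subrr mulmx0.
  rewrite dotZr => /eqP; rewrite mulf_eq0 (negPf fx) orbF => /eqP->.
  by rewrite scale0r.
have ker_mx (M : 'M[C]_3) : n *m M = 0 -> f *m M = 0 -> M = 0.
  move=> nM fM; apply/matrixP => i j.
  have : M *m delta_mx j (0 : 'I_1) = 0.
    apply: ker; first by rewrite mulmxA nM mul0mx.
    by rewrite /dot mulmxA fM mul0mx mxE.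
  by rewrite -colE => /colP/(_ i); rewrite !mxE.
(* From n^3 = 0 and f n = 0 one gets first n^2 = 0, then n = 0. Then a(ib) = 0, although [Hs] is off
   the longitudinal line. *)
have n0 : n = 0.
  by apply: (ker_mx) => //; apply: (ker_mx) => //; rewrite mulmxA fn mul0mx.
have /(longitudinal_kernel w0)[k Hk] : asymb S c ib *m Hs = 0.
  by rewrite fac -[ib%:M - q]opprB -nE n0 oppr0 mulmx0 mul0mx.
have := congr1 (dot N) Hk; rewrite !dots add0r mulr1 => /esym/eqP.
rewrite mulf_eq0 (negPf ib_neq0) orbF => /eqP k0.
have := congr1 (dot H) Hk; rewrite k0 scale0r !dots => /eqP.
exact/negP/hC_neq0.
Qed.

(** * The impedance from longitudinal and shear modes *)

Section Modes.
Variables (sg : C).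
Hypothesis hs : m * (h - sg ^+ 2) = w.
Hypothesis qs : eigenvalue q ('i%C * sg).

Local Notation D := (h - b%:C * sg).
Hypothesis D0 : D != 0.

Lemma ibE : ib = 'i%C * b%:C.
Proof. by simpc. Qed.

(** The kernel of xi(i sg) consists of shear modes and is transversal to the longitudinal line,
    because xi(i sg) xi^#(ib) = D is nonzero; [k] is the quotient of the two pairings. *)
Lemma mode_decomposition v : exists v',
  let k := (dot H v + 'i%C * sg * dot N v) / D in
  [/\ v = k *: xis ib + v', dot (xi ('i%C * sg)) v' = 0 &
      q *m v' = ('i%C * sg) *: v'].
Proof.
set k := _ / D; exists (v - k *: xis ib).
have xv : dot (xi ('i%C * sg)) (v - k *: xis ib) = 0.
  have DE : D = h + 'i%C * sg * ib.
    by rewrite ibE mulrACA -expr2 sqr_i; ring.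
  have kD : k * D = dot H v + 'i%C * sg * dot N v by rewrite divfK.
  rewrite -scaleNr dotDr dotZr dot_xi2 -DE mulNr kD.
  by rewrite dotDl dotZl subrr.
split=> //; first by rewrite addrC subrK.
apply: outgoing_eigenvector => //.
rewrite asymb_mul xv mulr0 scale0r add0r exprMn sqr_i mulN1r hs subrr.
by rewrite scale0r.
Qed.

Lemma impedance_tangential v :
  dot H (- ('i)%C *: (toC (a0 S) *m q + toC (a1 S c)) *m v) =
  w / D * b%:C * dot H v - 'i%C * h * (2 * m - w / D) * dot N v.
Proof.
have [v' [vE x0 qv']] := mode_decomposition v.
set k := _ / D in vE.
have Hv : dot H v' = dot H v - k * h.
  by rewrite vE !dots; ring.
have Nv : dot N v' = dot N v - k * ib.
  by rewrite vE !dots; ring.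
rewrite -scalemxAl dotZr mulmxDl -mulmxA.
have -> : q *m v = (k * ib) *: xis ib + ('i%C * sg) *: v'.
  by rewrite {1}vE mulmxDr -scalemxAr q_longitudinal qv' scalerA.
(* Pairing with [H] removes lambda, so [w] is eliminated by the shear relation [hs]. *)
rewrite a0_mul a1_mul !dots Hv Nv /k -hs ibE.
have := sqr_i R; have := D0.
move: ('i%C) (dot H v) (dot N v) m h b%:C sg => i x y m' h' b' s d0 i2.
field: i2; exact: d0.
Qed.

Lemma impedance_normal v :
  dot N (- ('i)%C *: (toC (a0 S) *m q + toC (a1 S c)) *m v) =
  'i%C * (2 * m - w / D) * dot H v + w / D * sg * dot N v.
Proof.
have [v' [vE x0 qv']] := mode_decomposition v.
set k := _ / D in vE.
have Nv : dot N v' = dot N v - k * ib.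
  by rewrite vE !dots; ring.
rewrite -scalemxAl dotZr mulmxDl -mulmxA.
have -> : q *m v = (k * ib) *: xis ib + ('i%C * sg) *: v'.
  by rewrite {1}vE mulmxDr -scalemxAr q_longitudinal qv' scalerA.
(* Here lambda survives, and [w] is eliminated by the longitudinal relation [hbC]. *)
rewrite a0_mul a1_mul !dots Nv /k -hbC ibE exprMn sqr_i.
have := sqr_i R; have := D0.
move: ('i%C) (dot H v) (dot N v) m l h b%:C sg => i x y m' l' h' b' s d0 i2.
field: i2; exact: d0.
Qed.

Lemma impedance_horizontal v : dot H v = 0 -> dot N v = 0 ->
  - ('i)%C *: (toC (a0 S) *m q + toC (a1 S c)) *m v = (m * sg) *: v.
Proof.
move=> Hv Nv; have [v' [vE x0 qv']] := mode_decomposition v.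
move: vE; rewrite Hv Nv mulr0 addr0 mul0r scale0r add0r => vE.
rewrite -scalemxAl mulmxDl -mulmxA {1}vE qv' -vE -scalemxAr a0_mul a1_mul Hv Nv.
rewrite !mulr0 !scale0r !add0r addr0 !scalerA; congr (_ *: _).
have := sqr_i R; move: ('i%C) m sg => i m' s i2.
ring: i2.
Qed.

(** On the two parts of the mode decomposition, (q - t)^3 acts by (ib - t)^3 and (i sg - t)^3. The
    latter is nonzero, as i sg is real and t is not, so the shear part vanishes. *)
Lemma geigenspace_longitudinal t :
  complex.Im ('i%C * sg) = 0 -> 0 < complex.Im t ->
  (geigenspace q^T t <= (xis ib)^T)%MS.
Proof.
move=> s0 t0; apply/row_subP => j; set u := row j _.
have : u *m (q^T - t%:M) ^+ 3 = 0.
  by apply/sub_kermxP; rewrite -geigenspaceE row_sub.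
rewrite !exprS expr0 mulr1 => u0.
have {u0} : (q - t%:M) *m ((q - t%:M) *m ((q - t%:M) *m u^T)) = 0.
  apply: trmx_inj; rewrite !trmx_mul trmxK trmx0 -[RHS]u0 linearB /=.
  by rewrite tr_scalar_mx -!mulmxA.
have [v' [vE x0 qv']] := mode_decomposition u^T.
set k := _ / D in vE; set s := 'i%C * sg in s0 x0 qv' *.
have step a a' : (q - t%:M) *m (a *: xis ib + a' *: v') =
    ((ib - t) * a) *: xis ib + ((s - t) * a') *: v'.
  have := q_longitudinal; move: (xis ib) => x qx.
  rewrite mulmxBl mul_scalar_mx mulmxDr -!scalemxAr qx qv'.
  by apply/colP => i; rewrite !mxE; ring.
rewrite vE -[v' in LHS]scale1r !step => e.
have Ds : dot (xi s) (xis ib) != 0.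
  rewrite dot_xi2 /s ibE mulrACA -expr2 sqr_i mulN1r mulrC; exact: D0.
have := congr1 (dot (xi s)) e; rewrite dotDr !dotZr x0 mulr0 addr0 dot0r.
move=> /eqP; rewrite mulf_eq0 (negPf Ds) orbF => /eqP k0.
move: e; rewrite k0 scale0r add0r mulr1 => /eqP.
have st : s - t != 0.
  by apply: contraTneq t0 => /eqP; rewrite subr_eq0 => /eqP <-; rewrite s0 ltxx.
rewrite scaler_eq0 !mulf_eq0 (negPf st) /= => /eqP v0.
by rewrite -[u]trmxK vE v0 addr0 linearZ /= scalemx_sub.
Qed.

End Modes.
End Longitudinal.
End Factor.

(** * The space [E_c] of evanescent modes *)

Lemma E_c_eigenvalue : E_c S c != 0 ->
  exists2 t, eigenvalue (q_out S c) t & 0 < complex.Im t.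
Proof.
move=> E0; apply: contrapT => no; move/negP: E0; apply.
rewrite -submx0; apply: big_addsmx_sub => z; rewrite mem_eigenvals => qz z0.
by case: no; exists z.
Qed.

(** Without an outgoing factor [q_out] would be the default 0, whose only eigenvalue 0 does not
    contribute to [E_c]. *)
Lemma q_out_factor : E_c S c != 0 -> outgoing_factor S c (q_out S c).
Proof.
move=> /E_c_eigenvalue [t]; rewrite /q_out; case: xgetP => // _.
move=> /eigenvalueP [v]; rewrite mulmx0 => /esym/eqP.
rewrite scaler_eq0 => /orP[/eqP->|/eqP->]; first by rewrite ltxx.
by rewrite eqxx.
Qed.

(** The cases are whether [q_out] has a real eigenvalue, necessarily a shear one, or not. The second
    impedance formula assumes 0 < wr: at wr = 0 both speeds give b^2 = sg^2 = h, and the denominator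
    h - b sg vanishes. *)
Lemma E_c_dichotomy : E_c S c != 0 ->
  (exists b th, [/\ 0 < b, b ^+ 2 < hr, th != 0 & 0 < wr] /\
     [/\ (E_c S c <= (xis (0 +i* b))^T)%MS &
         impedance S c hr wr mu b (0 +i* th)]) \/
  (row_full (E_c S c) /\
   (0 < wr -> exists b sg, [/\ 0 < sg, sg <= b, b ^+ 2 < hr &
      impedance S c hr wr mu b sg%:C])).
Proof.
move=> E0; have outq := q_out_factor E0; have [t qt t0] := E_c_eigenvalue E0.
have [b b0 hb] := longitudinal_speed outq qt t0.
have wb : 0 < wr -> b ^+ 2 < hr.
  by rewrite -hb pmulr_rgt0 ?lame_gt0 // subr_gt0.
have [[s qs s0]|noreal] :=
  pselect (exists2 s, eigenvalue (q_out S c) s & complex.Im s = 0).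
  have [th [th0 sE hs]] := real_eigenvalue outq b0 hb qs s0.
  (* sg = -i th makes i sg the given real eigenvalue. *)
  have isg : 'i%C * (0 +i* - th) = s by rewrite sE; simpc.
  have h0 := h_gt0 b0 hb.
  have w0 : 0 < wr by rewrite -hs mulr_gt0 // ltr_wpDr ?sqr_ge0.
  have D0 : h - b%:C * (0 +i* - th) != 0.
    by simpc; rewrite eq_complex /= negb_and lt0r_neq0.
  have hsC : m * (h - (0 +i* - th) ^+ 2) = w.
    have -> : (0 +i* - th) ^+ 2 = (- th ^+ 2)%:C by rewrite !expr2; simpc.
    by rewrite -rmorphB -rmorphM /= opprK hs.
  rewrite -isg in qs.
  left; exists b, (- th); split.
    by rewrite oppr_eq0; split=> //; exact: wb.
  split; last split.
  - apply: big_addsmx_sub => z _ z0.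
    apply: (geigenspace_longitudinal outq b0 hb hsC qs D0) => //.
    by rewrite isg.
  - exact: (impedance_tangential outq b0 hb hsC qs D0).
  - exact: (impedance_normal outq b0 hb hsC qs D0).
  - exact: (impedance_horizontal outq hsC qs D0).
have posq z : eigenvalue (q_out S c) z -> 0 < complex.Im z.
  move=> qz; rewrite lt_neqAle; apply/andP; split; last first.
    by have [] := (eigenvalue_out outq z).1 qz.
  by apply/eqP => /esym z0; apply: noreal; exists z.
right; split; first exact: row_full_sum_geigenspace.
move=> w0; have wh := shear_subcritical outq b0 hb posq.
pose sg := Num.sqrt (hr - wr / mu).
have sg0 : 0 < sg by rewrite sqrtr_gt0 subr_gt0 ltr_pdivrMr // [hr * _]mulrC.
have hs : mu * (hr - sg ^+ 2) = wr.
  rewrite sqr_sqrtr; first by field; exact: lt0r_neq0.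
  by rewrite subr_ge0 ler_pdivrMr // [hr * _]mulrC ltW.
(* At equal wr the smaller modulus mu <= lambda + 2 mu needs the larger hr - sg^2. *)
exists b, sg; have sgb : sg <= b.
  rewrite -(@ler_pXn2r _ 2) ?nnegrE ?(ltW sg0) ?(ltW b0) //.
  have : mu * (hr - b ^+ 2) <= mu * (hr - sg ^+ 2).
    have ml : mu <= lambda + 2 * mu by have := mu0; have := lmu0; lra.
    by rewrite hs -hb ler_wpM2r // subr_ge0 ltW // wb.
  by rewrite ler_pM2l // lerD2l lerN2.
have qs := shear_mode outq b0 hb sg0 hs.
have isg : 'i%C * sg%:C = 0 +i* sg by simpc.
have D0 : h - b%:C * sg%:C != 0.
  rewrite -rmorphM -rmorphB fmorph_eq0 lt0r_neq0 // subr_gt0.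
  by apply: le_lt_trans (wb w0); rewrite expr2 ler_pM2l //.
have hsC : m * (h - sg%:C ^+ 2) = w by rewrite -hs rmorphM rmorphB rmorphXn.
rewrite -isg in qs.
split=> //; first exact: wb.
split.
- exact: (impedance_tangential outq b0 hb hsC qs D0).
- exact: (impedance_normal outq b0 hb hsC qs D0).
- exact: (impedance_horizontal outq hsC qs D0).
Qed.

End Isotropic.

(** * Boundary and interface *)

Lemma unitmx_ker (K : fieldType) n (A : 'M[K]_n) :
  (forall v : 'cV_n, A *m v = 0 -> v = 0) -> A \in unitmx.
Proof.
move=> kerA; rewrite -unitmx_tr unitmxE unitfE; apply/negP => /det0P [f f0 fA].
move/negP: f0; apply; rewrite -[f]trmxK (kerA f^T) ?trmx0 //.
by apply: trmx_inj; rewrite trmx_mul trmxK trmx0.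
Qed.

(** Pairing with [H] shows that the two multiples agree; pairing with [N] then gives k (b + b') =
    0. *)
Lemma lines_cap0 (K : fieldType) n (H N : 'rV[K]_n) (Hs Ns : 'cV[K]_n) h b b'
    (u : 'rV[K]_n) :
  dot H Ns = 0 -> dot N Hs = 0 -> dot N Ns = 1 -> dot H Hs = h ->
  h != 0 -> b + b' != 0 ->
  (u <= (Hs + b *: Ns)^T)%MS -> (u <= (Hs - b' *: Ns)^T)%MS -> u = 0.
Proof.
move=> HN NH NN HH h0 bb.
have trE v : (u <= v^T)%MS -> exists k, u^T = k *: v.
  by move=> /sub_rVP[k ->]; exists k; rewrite linearZ /= trmxK.
move=> /trE[k e1] /trE[k' e2].
have eH : k * h = k' * h.
  have := congr1 (dot H) e1.
  by rewrite e2 -scaleNr !dotZr !dotDr !dotZr HN HH !mulr0 !addr0.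
have eN : k * (b + b') = 0.
  have := congr1 (dot N) e1.
  rewrite e2 -scaleNr !dotZr !dotDr !dotZr NH NN -(mulIf h0 eH).
  by rewrite !add0r !mulr1 mulrN mulrDr => <-; rewrite addrC subrr.
move/eqP: eN; rewrite mulf_eq0 (negPf bb) orbF => /eqP k0.
by rewrite -[u]trmxK e1 k0 scale0r trmx0.
Qed.

(** The 2 x 2 system has determinant a f - h e^2; both parts are Cramer's rule. *)
Lemma psv_injective (R : realType) (h a e f x y : R[i]) :
  a * f != h * e ^+ 2 ->
  a * x - 'i%C * h * e * y = 0 -> 'i%C * e * x + f * y = 0 -> x = 0 /\ y = 0.
Proof.
rewrite -subr_eq0 => d0 e1 e2; have i2 := sqr_i R.
have solve z : (a * f - h * e ^+ 2) * z = 0 -> z = 0.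
  by move/eqP; rewrite mulf_eq0 (negPf d0) => /eqP.
split; apply: solve.
  transitivity (f * (a * x - 'i%C * h * e * y) +
    'i%C * h * e * ('i%C * e * x + f * y)).
    move: ('i%C) i2 => i i2; ring: i2.
  by rewrite e1 e2 !mulr0 addr0.
transitivity (a * ('i%C * e * x + f * y) -
  'i%C * e * (a * x - 'i%C * h * e * y)).
  move: ('i%C) i2 => i i2; ring: i2.
by rewrite e1 e2 !mulr0 subr0.
Qed.

(** This form serves boundary and interface alike: unprimed data come from the side with propagating
    shear waves, primed data and [k] from the other side, and are 0 at the boundary. Off the plane
    of [Hs] and [Ns] the factor has imaginary part mu th. *)
Lemma mixed_impedance_unit (R : realType) (Z : 'M[R[i]]_3) (H N : 'rV[R[i]]_3)
    (h w mm mu b th b' sg' r' k : R) :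
  let r := w%:C / (h%:C - b%:C * (0 +i* th)) in
  let e := mm%:C + r'%:C - r in
  0 < mu -> 0 < b -> b ^+ 2 < h -> th != 0 -> 0 < w -> 0 <= r' ->
  0 <= sg' <= b' ->
  (forall v, dot H (Z *m v) =
    (b%:C * r + b'%:C * r'%:C) * dot H v - 'i%C * h%:C * e * dot N v) ->
  (forall v, dot N (Z *m v) =
    'i%C * e * dot H v + ((0 +i* th) * r + sg'%:C * r'%:C) * dot N v) ->
  (forall v, dot H v = 0 -> dot N v = 0 ->
    Z *m v = (mu%:C * (0 +i* th) + k%:C) *: v) ->
  Z \in unitmx.
Proof.
move=> r e mu0 b0 bh th0 w0 r'0 sgb zH zN zh; apply: unitmx_ker => v zv.
have d0 : h%:C - b%:C * (0 +i* th) != 0.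
  simpc; rewrite eq_complex /= negb_and lt0r_neq0 //.
  by apply: le_lt_trans bh; rewrite sqr_ge0.
have rE : r * (h%:C - b%:C * (0 +i* th)) = w%:C by rewrite divfK.
have det := psv_determinant_neq0 mm b0 bh th0 w0 r'0 sgb rE.
have := zH v; have := zN v; rewrite zv !dot0r => /esym e2 /esym e1.
have [x0 y0] := psv_injective det e1 e2.
move: (zh v x0 y0); rewrite zv => /esym/eqP; rewrite scaler_eq0.
case/orP=> /eqP // /(congr1 (@complex.Im R)) /eqP; simpc => /=.
by rewrite mulf_eq0 (negPf th0) orbF (negPf (lt0r_neq0 mu0)).
Qed.

(** * Invertibility at the boundary and across the interface *)

Section TwoSides.
Variables (R : realType) (c : 'rV[R]_3 * R).
Local Notation toC := (map_mx (fun x : R => (x%:C)%C)).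

Lemma boundary_unit (S : side R) h w mu b th :
  0 < mu -> 0 < b -> b ^+ 2 < h -> th != 0 -> 0 < w ->
  impedance S c h w mu b (0 +i* th) -> z_out S c \in unitmx.
Proof.
move=> mu0 b0 bh th0 w0 [zH zN zh].
have mu2 : (2 * mu)%:C = 2 * mu%:C by rewrite !mulr_natl rmorphMn.
have z00 : (0 : R) <= (0 : R) <= (0 : R) by rewrite lexx.
apply: (mixed_impedance_unit (H := toC c.1)
  (N := toC (conormal S)) (mm := 2 * mu) (k := 0)
  mu0 b0 bh th0 w0 (lexx 0) z00).
- by move=> v; rewrite zH mu2; set r := _ / _; ring.
- by move=> v; rewrite zN mu2; set r := _ / _; ring.
- by move=> v Hv Nv; rewrite addr0 zh.
Qed.

(** Reversing the conormal changes the sign of the off-diagonal terms only, so 2 mu - r becomes 2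
    (mu - mu') + r' - r, while diagonal terms add up. As b' sg' < h, r' is real and positive. *)
Lemma interface_unit (S S' : side R) h w w' mu mu' b th b' sg' :
  conormal S' = - conormal S ->
  0 < mu -> 0 < b -> b ^+ 2 < h -> th != 0 -> 0 < w ->
  impedance S c h w mu b (0 +i* th) ->
  0 < w' -> 0 < sg' -> sg' <= b' -> b' ^+ 2 < h ->
  impedance S' c h w' mu' b' sg'%:C ->
  z_out S c + z_out S' c \in unitmx.
Proof.
move=> nuS mu0 b0 bh th0 w0 [zH zN zh] w'0 sg0 sgb bh' [zH' zN' zh'].
pose r' := w' / (h - b' * sg').
have d'0 : 0 < h - b' * sg'.
  rewrite subr_gt0; apply: le_lt_trans bh'; rewrite expr2 ler_pM2l //.
  exact: lt_le_trans sgb.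
have r'E : w'%:C / (h%:C - b'%:C * sg'%:C) = r'%:C.
  by rewrite -rmorphM -rmorphB -fmorph_div.
rewrite {}r'E in zH' zN'.
have Ndot v : dot (toC (conormal S')) v =
    - dot (toC (conormal S)) v.
  by rewrite nuS map_mxN -scaleN1r dotZl mulN1r.
have mu2 : (2 * (mu - mu'))%:C = 2 * mu%:C - 2 * mu'%:C.
  by rewrite !mulr_natl rmorphMn rmorphB mulrnBl.
have sgb' : 0 <= sg' <= b' by rewrite (ltW sg0).
have r'0 : 0 <= r' by apply: divr_ge0; exact: ltW.
apply: (mixed_impedance_unit (H := toC c.1)
  (N := toC (conormal S)) (mm := 2 * (mu - mu')) (k := mu' * sg')
  mu0 b0 bh th0 w0 r'0 sgb').
- move=> v; rewrite mulmxDl dotDr zH zH' Ndot mu2.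
  set r := w%:C / _; ring.
- move=> v; rewrite mulmxDl dotDr zN; have := zN' v; rewrite !Ndot mu2.
  move=> /(canRL (@opprK _)) ->; set r := w%:C / _; ring.
- move=> v Hv Nv; rewrite mulmxDl zh // zh' ?Ndot ?Nv ?oppr0 //.
  by rewrite -scalerDl rmorphM.
Qed.

Lemma longitudinal_lines_cap0 (S S' : side R) b b' (A A' : 'M[R[i]]_3) :
  metric S' = metric S -> conormal S' = - conormal S ->
  codot (metric S) c.1 (conormal S) = 0 -> 0 < codot (metric S) c.1 c.1 ->
  0 < b -> 0 < b' ->
  (A <= (toC (invmx (metric S) *m c.1^T) +
    (0 +i* b) *: toC (invmx (metric S) *m (conormal S)^T))^T)%MS ->
  (A' <= (toC (invmx (metric S') *m c.1^T) +
    (0 +i* b') *: toC (invmx (metric S') *m (conormal S')^T))^T)%MS ->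
  (A :&: A')%MS = 0.
Proof.
move=> -> -> cot h0 b0 b'0 sA sA'; apply/eqP/rowV0P => u.
rewrite sub_capmx => /andP[/submx_trans/(_ sA) u1 /submx_trans/(_ sA') u2].
have nE : toC (invmx (metric S) *m (- conormal S)^T) =
    - toC (invmx (metric S) *m (conormal S)^T).
  by rewrite linearN mulmxN map_mxN.
rewrite nE scalerN in u2.
apply: lines_cap0 (dotHN cot) (dotNH cot) (dotNN S) (dotHH erefl) _ _ u1 u2.
  by rewrite fmorph_eq0 lt0r_neq0.
by simpc; rewrite eq_complex /= eqxx /= lt0r_neq0 // addr_gt0.
Qed.

End TwoSides.

Theorem proposition8p2 (R : realType) (B : elastic_body R)
    (isoB : isotropic_body B) :
  elliptic_on (bdry_mixed (B := B)) (bdry_Z_out (B := B)) /\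
  elliptic_on (intf_mixed (B := B)) (intf_Z_out (B := B)).
Proof.
have [isob isop ison] := isoB; split=> -[y c].
  case=> ng /not_orP[nh ne]; rewrite /bdry_Z_out /=; have [/= [cot _] _] := ng.
  have E0 : E_c (bdry_side y) c != 0 by apply/eqP => E0; apply: nh; split.
  have [la [mu [mu0 lmu0 sE]]] := isob y.
  have := E_c_dichotomy sE cot erefl erefl mu0 lmu0 E0.
  (* A full [E_c] would put the point in the elliptic region. *)
  case=> [[b [th [[b0 bh th0 w0] [_ im]]]]|[full _]].
    exact: (boundary_unit mu0 b0 bh th0 w0 im).
  by case: ne; split.
case=> ng /not_orP[nh ne]; rewrite /intf_Z_out /=; have [/= [cot _] _ _] := ng.
have Ecap : (E_c (intf_pos y) c :&: E_c (intf_neg y) c)%MS != 0.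
  by apply/eqP => E0; apply: nh; split.
have Ep : E_c (intf_pos y) c != 0.
  by apply: contraNneq Ecap => ->; rewrite cap0mx.
have En : E_c (intf_neg y) c != 0.
  by apply: contraNneq Ecap => ->; rewrite capmx0.
have gE := intf_metric y; have nE := intf_conormal y.
have cotn : codot (metric (intf_neg y)) c.1 (conormal (intf_neg y)) = 0.
  by rewrite gE nE codotC /codot !mulNmx mxE -/(codot _ _ _) codotC cot oppr0.
have [la [mu [mu0 lmu0 sE]]] := isop y.
have [la' [mu' [mu'0 lmu'0 sE']]] := ison y.
have dp := E_c_dichotomy sE cot erefl erefl mu0 lmu0 Ep.
have hn : codot (metric (intf_neg y)) c.1 c.1 =
    codot (metric (intf_pos y)) c.1 c.1.
  by rewrite gE.
have dn := E_c_dichotomy sE' cotn hn erefl mu'0 lmu'0 En.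
(* Both sides share tau, so rho tau^2 is positive on both or on neither. *)
have wE (S S' : side R) : 0 < density S * c.2 ^+ 2 -> 0 < density S' * c.2 ^+ 2.
  by rewrite (pmulr_rgt0 _ (density_pos S)) (pmulr_rgt0 _ (density_pos S')).
case: dp dn => [[b [th [[b0 bh th0 w0] [Eb im]]]]|[full elp]].
  case=> [[b' [th' [[b'0 bh' th'0 w'0] [Eb' im']]]]|[full /(_ (wE _ _ w0))]].
    (* Propagating shear waves on both sides: the two longitudinal lines meet in 0, against
       [Ecap]. *)
    have h0 : 0 < codot (metric (intf_pos y)) c.1 c.1.
      by apply: le_lt_trans bh; rewrite sqr_ge0.
    move: Ecap.
    by rewrite (longitudinal_lines_cap0 gE nE cot h0 b0 b'0 Eb Eb') eqxx.
  case=> [b' [sg [sg0 sgb bh' im']]].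
  exact: (interface_unit nE mu0 b0 bh th0 w0 im (wE _ _ w0) sg0 sgb bh' im').
case=> [[b' [th' [[b'0 bh' th'0 w'0] [_ im']]]]|[full' _]]; last first.
  by case: ne; split; [exact: ng | exact: full | exact: full'].
have [b [sg [sg0 sgb bh im]]] := elp (wE _ _ w'0).
(* The last case exchanges the roles of the two sides. *)
have nE' : conormal (intf_pos y) = - conormal (intf_neg y) by rewrite nE opprK.
rewrite addrC.
exact: (interface_unit nE' mu'0 b'0 bh' th'0 w'0 im' (wE _ _ w'0)
  sg0 sgb bh im).
Qed.
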